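(* Let $(X,T,\lambda)$ be a $T$-space, let $T$ be compact and let $\lambda$ be perfect. Then: (i) the projection map $\pi:X\to X/T$ is a closed map; (ii) the quotient space $X/T$ is Hausdorff; (iii) the projection map $\pi:X\to X/T$ is a proper map; (iv) $X$ is compact if and only if $X/T$ is compact; (v) $X$ is locally compact if and only if $X/T$ is locally compact.
   Context: A generalized group is a semigroup $T$ such that (i) for each $t\in T$ there exists a unique $e(t)\in T$ with $t\cdot e(t)=e(t)\cdot t=t$; (ii) for each $t\in T$ there exists $s\in T$ with $s\cdot t=t\cdot s=e(t)$. The element $s$ in (ii) is unique and denoted $t^{-1}$. A topological generalized group is a Hausdorff topological space $T$ endowed with a generalized group structure such that $t\mapsto t^{-1}$ and $(s,t)\mapsto s\cdot t$ are continuous and $e(s\cdot t)=e(s)\cdot e(t)$ for all $s,t\in T$. Write $e(T)=\{e(t)\mid t\in T\}$. A generalized action of a topological generalized group $T$ on a topological space $X$ is a continuous map $\lambda:T\times X\to X$ such that (i) $\lambda(s,\lambda(t,x))=\lambda(s\cdot t,x)$ for all $s,t\in T$, $x\in X$; (ii) for each $x\in X$ there is an element of the form $e(t)\in T$ with $\lambda(e(t),x)=x$. One writes $tx$ for $\lambda(t,x)$. A $T$-space is a triple $(X,T,\lambda)$ where $X$ is a Hausdorff topological space, $T$ is a topological generalized group and $\lambda$ is a generalized action of $T$ on $X$. The stabilizer of $x\in X$ is $T_x=\{t\in T\mid tx=x\}$. The generalized action $\lambda$ is called perfect if $e(T)\subseteq T_x$ for each $x\in X$. The relation $x\sim y$ iff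 there is $t\in T$ with $tx=y$ is an equivalence relation on $X$; $X/T$ denotes the quotient space $X/{\sim}$ with the quotient topology and $\pi:X\to X/T$ is the canonical projection. A map $f:X\to Y$ of topological spaces is called proper if $f^{-1}(A)$ is a compact subset of $X$ for each compact subset $A$ of $Y$. *)

(* Defs.v *)
From HB Require Import structures.
From mathcomp Require Import all_boot all_classical topology.

Set Implicit Arguments.
Unset Strict Implicit.
Unset Printing Implicit Defensive.

Local Open Scope classical_set_scope.
Local Open Scope quotient_scope.
Local Open Scope group_scope.

(* In the mathematical definition [gunit t] and [ginv t] are asserted to exist
   and [gunit t] to be unique. Uniqueness of [ginv t] follows from these axioms,
   so both operations are determined by the product. *)
HB.mixin Record Semigroup_isGenGroup G of Semigroup G := {
  gunit : G -> G;
  ginv : G -> G;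
  mulg_gunit : forall t : G, t * gunit t = t;
  gunit_mulg : forall t : G, gunit t * t = t;
  gunit_unique : forall t u : G, t * u = t -> u * t = t -> u = gunit t;
  ginv_mulg : forall t : G, ginv t * t = gunit t;
  mulg_ginv : forall t : G, t * ginv t = gunit t
}.

#[short(type="genGroupType")]
HB.structure Definition GenGroup :=
  {G of Semigroup_isGenGroup G & Semigroup G}.

HB.mixin Record isTopGenGroup G of Topological G & GenGroup G := {
  topgg_hausdorff : hausdorff_space G;
  ginv_continuous : continuous (ginv : G -> G);
  mulg_continuous : continuous (fun p : G * G => p.1 * p.2);
  gunitM : forall s t : G, gunit (s * t) = gunit s * gunit t
}.

#[short(type="topGenGroupType")]
HB.structure Definition TopGenGroup :=
  {G of isTopGenGroup G & Topological G & GenGroup G}.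

Definition gunits (T : genGroupType) : set T := range (@gunit T).

Record genAction (T : topGenGroupType) (X : topologicalType) := GenAction {
  gact :> T -> X -> X;
  gact_continuous : continuous (fun p : T * X => gact p.1 p.2);
  gactM : forall (s t : T) (x : X), gact s (gact t x) = gact (s * t) x;
  gact_gunit : forall x : X, exists t : T, gact (gunit t) x = x
}.

Definition stabilizer (T : topGenGroupType) (X : topologicalType)
  (lam : genAction T X) (x : X) : set T := [set t | lam t x = x].

Definition perfect_action (T : topGenGroupType) (X : topologicalType)
  (lam : genAction T X) := forall x : X, @gunits T `<=` stabilizer lam x.

Lemma gunit_idem (T : genGroupType) (t : T) : gunit t * gunit t = gunit t.
Proof.
apply: gunit_unique; first by rewrite mulgA !mulg_gunit.
by rewrite -mulgA !gunit_mulg.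
Qed.

Lemma gunit_gunit (T : genGroupType) (t : T) : gunit (gunit t) = gunit t.
Proof. by apply/esym/gunit_unique; exact: gunit_idem. Qed.

Lemma gunit_rect (T : topGenGroupType) (s t : T) :
  gunit s * gunit t * gunit s = gunit s.
Proof.
set g := gunit s; set f := gunit t; set x := g * f * g.
have ex : gunit x = x by rewrite /x !gunitM !gunit_gunit.
rewrite -ex; apply/esym/gunit_unique; rewrite /x.
  by rewrite -mulgA gunit_idem.
by rewrite !mulgA gunit_idem.
Qed.

Section OrbitSpace.
Context (T : topGenGroupType) (X : topologicalType) (lam : genAction T X).

Definition orbit_rel : rel X := fun x y => `[< exists t : T, lam t x = y >].

Lemma orbit_rel_refl : reflexive orbit_rel.
Proof.
by move=> x; apply/asboolP; have [t tx] := gact_gunit lam x; exists (gunit t).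
Qed.

Lemma orbit_rel_trans : transitive orbit_rel.
Proof.
move=> y x z /asboolP[s sx] /asboolP[t ty]; apply/asboolP; exists (t * s).
by rewrite -gactM sx.
Qed.

Lemma orbit_rel_sym : symmetric orbit_rel.
Proof.
have half x y : orbit_rel x y -> orbit_rel y x.
  move=> /asboolP[t <-]; apply/asboolP; have [s sx] := gact_gunit lam x.
  exists (gunit s * ginv t).
  rewrite -[in LHS]sx !gactM -(mulgA (gunit s)) mulgA -(mulgA (gunit s)).
  by rewrite ginv_mulg gunit_rect.
by move=> x y; apply/idP/idP; exact: half.
Qed.

Definition orbit_equiv :=
  EquivRel orbit_rel orbit_rel_refl orbit_rel_sym orbit_rel_trans.

Definition orbit_space := {eq_quot orbit_equiv}.

HB.instance Definition _ :=
  Topological.copy orbit_space (quotient_topology orbit_space).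
HB.instance Definition _ := Quotient.on orbit_space.

Definition orbit_proj : X -> orbit_space := \pi_orbit_space.

End OrbitSpace.

Definition closed_map (X Y : topologicalType) (f : X -> Y) :=
  forall A : set X, closed A -> closed (f @` A).

Definition proper_map (X Y : topologicalType) (f : X -> Y) :=
  forall A : set Y, compact A -> compact (f @^-1` A).

(* Main.v *)
Require Import Defs.
From mathcomp Require Import all_boot all_classical topology.
From mathcomp Require Import generic_quotient.

(** The orbit relation is symmetric, so the saturation of a set of points by
    the action can be described through forward translates: [y] lies outside
    the saturation of [A] exactly when no translate [lam t y] is in [A]. A
    condition asked of all the translates of [y] is a condition on the slice
    [T * {y}], and since [T] is compact the tube lemma says that it persists
    when [y] moves a little ([near_orbit]). This is the only use of compactness
    of [T], and it is stated for conditions depending also on a parameter that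
    tends along a filter, so that each part is an instance of it:

    - closedness of the projection: the condition is to avoid a closed set;
    - separation of two orbits [T x] and [T y]: the condition on a point is to
      differ from a parameter tending to [y], and its stable form provides
      neighbourhoods of [x] and [y] no two points of which are in the same
      orbit;
    - properness: compactness of a set is the statement that conditions holding
      near each of its points eventually hold on the whole set, and the tube
      lemma moves such conditions from the points of an orbit to the orbit
      itself.

    To come back from [X] to the orbit space one needs that the projection is
    open ([orbit_proj_nbhs]), because the saturation of an open set is a union
    of its preimages by translations. Global and local compactness then pass
    forward along the continuous open surjection and backward along the
    proper map. *)

Local Open Scope classical_set_scope.

Lemma locally_compactTE (X : topologicalType) :
  locally_compact [set: X] =
  forall x : X, exists2 K, nbhs x K & compact K /\ closed K.
Proof.
rewrite propeqE; split=> [lc x|lc x _].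
  by have [K + cK] := lc x I; rewrite withinET; exists K.
by have [K xK cK] := lc x; exists K => //; rewrite withinET.
Qed.

Section OrbitProjection.
Context (T : topGenGroupType) (X : topologicalType) (lam : genAction T X).

Local Notation pi := (orbit_proj lam).

Lemma orbit_projP (x y : X) : pi x = pi y <-> exists t : T, lam t x = y.
Proof.
split=> [/(@eqmodP _ (orbit_equiv lam))/asboolP //|xy].
by apply/(@eqmodP _ (orbit_equiv lam))/asboolP.
Qed.

Lemma orbit_proj_gact (t : T) (x : X) : pi (lam t x) = pi x.
Proof. by apply/esym/orbit_projP; exists t. Qed.

Lemma orbit_proj_surj (q : orbit_space lam) : exists x : X, pi x = q.
Proof. by exists (repr q); exact: reprK. Qed.

Lemma orbit_proj_continuous : continuous pi.
Proof. exact: pi_continuous. Qed.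

Lemma gact_continuousr (t : T) : continuous (lam t).
Proof.
move=> x; apply: (@continuous_comp _ _ _ (fun x => (t, x))
  (fun p : T * X => lam p.1 p.2)); last exact: gact_continuous.
by apply: cvg_pair; [exact: cvg_cst|exact: cvg_id].
Qed.

(** Symmetry of the orbit relation makes the saturation of [U] the union over
    [t] of the preimages of [U] by [lam t]. *)
Lemma open_orbit_proj (U : set X) : open U -> open (pi @` U).
Proof.
move=> oU; suff : open (pi @^-1` (pi @` U)) by [].
have -> : pi @^-1` (pi @` U) = \bigcup_(t in [set: T]) (lam t @^-1` U).
  rewrite eqEsubset; split=> [y [x Ux /esym/orbit_projP[t tyx]]|y [t _ Uty]].
    by exists t => //=; rewrite tyx.
  by exists (lam t y) => //; exact: orbit_proj_gact.
apply: bigcup_open => t _; apply: open_comp => // y _.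
exact: gact_continuousr.
Qed.

Lemma orbit_proj_nbhs (x : X) (U : set X) : nbhs x U -> nbhs (pi x) (pi @` U).
Proof.
rewrite nbhsE => -[V [oV Vx] VU].
apply: (@filterS _ _ _ (pi @` V)); first exact: image_subset.
by apply: open_nbhs_nbhs; split; [exact: open_orbit_proj|exists x].
Qed.

Hypothesis compT : compact [set: T].

(** A tube lemma: the condition [P i (lam t x')] holds near each point of the
    slice [T * {x}], by continuity of the action, so near the whole slice since
    [T] is compact. *)
Lemma near_orbit (I : Type) (F : set_system I) (P : I -> X -> Prop) (x : X) :
  Filter F -> (forall t : T, \forall z \near lam t x & i \near F, P i z) ->
  \forall x' \near x & i \near F, forall t : T, P i (lam t x').
Proof.
move=> FF near_tx; have /compact_near_coveringP covT := compT.
have [|[U G] [/= xU FG] UG] := covT _ (filter_prod (nbhs x) F)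
    (fun xi t => P xi.2 (lam t xi.1)) _; last first.
  by exists (U, G) => // -[x' i] /= UGx' t; exact: (UG (x', i)).
move=> t _; have [[W G] [/= txW FG] WG] := near_tx t.
have [[S U] [/= tS xU] SU] := @gact_continuous _ _ lam (t, x) _ txW.
exists (S, U `*` G); first by split=> //; exists (U, G).
move=> [t' [x' i]] /= [St' [Ux' Gi]].
by apply: (WG (_, _)); split=> //; exact: (SU (t', x')).
Qed.

Lemma closed_orbit_proj : closed_map pi.
Proof.
move=> A cA; rewrite -openC.
suff : open (pi @^-1` (~` (pi @` A))) by [].
rewrite openE => x /= piAx.
(* The condition has no parameter; any proper filter serves. *)
have [|[U V] [/= xU xV] UV] :=
    @near_orbit X (nbhs x) (fun _ z => ~ A z) x _ _.
  move=> t; exists (~` A, setT); last by move=> [z i] [].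
  split; last exact: filterT.
  apply: open_nbhs_nbhs; split; first by rewrite openC.
  by move=> Atx; apply: piAx; exists (lam t x); rewrite ?orbit_proj_gact.
apply: filterS xU => y Uy [a Aa /esym/orbit_projP[t tya]].
by apply: (UV (y, x) _ t); [split=> //; exact: nbhs_singleton|rewrite tya].
Qed.

Lemma hausdorff_orbit_space :
  hausdorff_space X -> hausdorff_space (orbit_space lam).
Proof.
move=> hausX p q; have [x <-] := orbit_proj_surj p.
have [y <-] := orbit_proj_surj q.
apply: contraPP => pixy.
have [|[U V] [/= xU yV] UV] := @near_orbit X (nbhs y) (fun i z => z <> i) x _ _.
  move=> t; have txy : lam t x != y.
    by apply/eqP => txy; apply: pixy; apply/orbit_projP; exists t.
  have := hausX; rewrite open_hausdorff => /(_ _ _ txy)[[U V]] /=.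
  rewrite !inE => -[Utx Vy] [oU oV UV0].
  exists (U, V); first by split=> /=; exact: open_nbhs_nbhs.
  by move=> [z i] /= [Uz Vi] zi; have : (U `&` V) z;
    [split=> //; rewrite zi|rewrite UV0].
move=> /(_ _ _ (orbit_proj_nbhs _ _ xU) (orbit_proj_nbhs _ _ yV)).
move=> [_ [[u Uu <-] [v Vv /esym/orbit_projP[t tuv]]]].
exact: (UV (u, v) _ t).
Qed.

(** Through [compact_near_coveringP]: a condition to be checked on the preimage
    of [A] is turned into the condition on an orbit that all its points satisfy
    it, which is stable near each orbit by [near_orbit]. *)
Lemma proper_orbit_proj : proper_map pi.
Proof.
move=> A /compact_near_coveringP covA; apply/compact_near_coveringP.
move=> I F P FF near_pix.
have near_q q : A q -> \forall q' \near q & i \near F,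
    forall x, pi x = q' -> P i x.
  have [x <-] := orbit_proj_surj q => Apix.
  have [|[U G] [/= xU FG] UG] := @near_orbit I F P x FF.
    by move=> t; apply: near_pix; rewrite /= orbit_proj_gact.
  exists (pi @` U, G); first by split=> //=; exact: orbit_proj_nbhs.
  move=> [_ i] /= [[u Uu <-] Gi] z /esym/orbit_projP[t <-].
  exact: (UG (u, i)).
have := covA _ F (fun i q => forall x, pi x = q -> P i x) FF near_q.
by apply: filterS => i AP x Apix; exact: (AP _ Apix x).
Qed.

Lemma orbit_proj_compact (A : set X) : compact A -> compact (pi @` A).
Proof.
apply: continuous_compact; apply: continuous_subspaceT.
exact: orbit_proj_continuous.
Qed.

Lemma compact_orbit_space :
  compact [set: X] <-> compact [set: orbit_space lam].
Proof.
split=> [/orbit_proj_compact|/proper_orbit_proj]; last by rewrite preimage_setT.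
rewrite (_ : pi @` setT = setT)// -subTset => q _.
by have [x <-] := orbit_proj_surj q; exists x.
Qed.

(** Local compactness asks for closed compact neighbourhoods, so the forward
    direction uses that the projection is closed as well as open. *)
Lemma locally_compact_orbit_space :
  locally_compact [set: X] <-> locally_compact [set: orbit_space lam].
Proof.
rewrite !locally_compactTE; split=> lc.
  move=> q; have [x <-] := orbit_proj_surj q.
  have [K xK [cptK cK]] := lc x.
  exists (pi @` K); first exact: orbit_proj_nbhs.
  by split; [exact: orbit_proj_compact|exact: closed_orbit_proj].
move=> x; have [K xK [cptK cK]] := lc (pi x).
exists (pi @^-1` K); first exact: orbit_proj_continuous.
split; first exact: proper_orbit_proj.
by apply: closed_comp => // z _; exact: orbit_proj_continuous.
Qed.

End OrbitProjection.

Theorem theorem2p16 (T : topGenGroupType) (X : topologicalType)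
    (lam : genAction T X) (hausX : hausdorff_space X)
    (compT : compact [set: T]) (perf : perfect_action lam) :
  [/\ closed_map (orbit_proj lam),
      hausdorff_space (orbit_space lam),
      proper_map (orbit_proj lam),
      compact [set: X] <-> compact [set: orbit_space lam] &
      locally_compact [set: X] <-> locally_compact [set: orbit_space lam]].
Proof.
split.
- exact: closed_orbit_proj.
- exact: hausdorff_orbit_space.
- exact: proper_orbit_proj.
- exact: compact_orbit_space.
- exact: locally_compact_orbit_space.
Qed.
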